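(* If $i\ge2$ and $c,d\in[i]$, then the vincular patterns $12\cdots i\text{-}c$ and $12\cdots i\text{-}d$ are Wilf-equivalent.
   Context: For $k\ge1$ let $[k]=\{1,\dots,k\}$; a $k$-ary word of length $n$ is an element of $[k]^n$. Two words are order-isomorphic if replacing the $i$-th smallest distinct letter by $i$ yields the same word. The vincular pattern $12\cdots i\text{-}c$ (underlying word $12\cdots i\,c$) occurs in a word $w=w_1\cdots w_n$ if there are indices $p<p+1<\dots<p+i-1<q$ such that $w_pw_{p+1}\cdots w_{p+i-1}w_q$ is order-isomorphic to $12\cdots i\,c$ (i.e., the first $i$ letters of the occurrence are consecutive in $w$); otherwise $w$ avoids it. For a pattern $\sigma$, $a_\sigma(n,k)$ is the number of words in $[k]^n$ avoiding $\sigma$; $\sigma\sim\tau$ (Wilf-equivalence) means $a_\sigma(n,k)=a_\tau(n,k)$ for all $n\ge0,k\ge1$. *)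

(* Defs.v *)
From mathcomp Require Import all_boot.

Set Implicit Arguments.
Unset Strict Implicit.
Unset Printing Implicit Defensive.

(* Replaces the i-th smallest distinct letter of s by i, with i counted
   from 1. *)
Definition standardize (s : seq nat) : seq nat :=
  [seq (index x (sort leq (undup s))).+1 | x <- s].

Definition order_isomorphic (s t : seq nat) : bool :=
  standardize s == standardize t.

(* VPattern u c is the vincular pattern u-c: the letters matching u are
   consecutive, the letter matching c is anywhere to their right. *)
Record vpattern := VPattern { vblock : seq nat; vlast : nat }.

Definition underlying (sigma : vpattern) : seq nat :=
  rcons (vblock sigma) (vlast sigma).

(* Positions are counted from 0. *)
Definition occurs_at (sigma : vpattern) (w : seq nat) (p q : nat) : bool :=
  let b := size (vblock sigma) in
  (p + b <= q) &&
  order_isomorphic (rcons (take b (drop p w)) (nth 0 w q)) (underlying sigma).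

Definition occurs (sigma : vpattern) (w : seq nat) : bool :=
  [exists p : 'I_(size w), exists q : 'I_(size w), occurs_at sigma w p q].

Definition avoids (sigma : vpattern) (w : seq nat) : bool := ~~ occurs sigma w.

(* x : 'I_k, of value 0 .. k-1, stands for the letter x + 1 of [k]. *)
Definition letters (n k : nat) (w : n.-tuple 'I_k) : seq nat :=
  [seq (val x).+1 | x <- w].

Definition num_avoiders (sigma : vpattern) (n k : nat) : nat :=
  #|[set w : n.-tuple 'I_k | avoids sigma (letters w)]|.

Definition wilf_equivalent (sigma tau : vpattern) : Prop :=
  forall n k : nat, 1 <= k -> num_avoiders sigma n k = num_avoiders tau n k.

(* 12...i-c *)
Definition increasing_pattern (i c : nat) : vpattern := VPattern (iota 1 i) c.

(* Main.v *)
Require Import Defs.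
From mathcomp Require Import all_boot.
From mathcomp Require Import zify.

(* A word contains 12...i-c iff some i consecutive letters increase and the c-th
   of them reappears later.  By inclusion-exclusion over the set T of starting
   positions of such blocks, it suffices that, for fixed T, the number of words
   for which every element of T starts such a block does not depend on c.  These
   words are given by forced ascents (depending on T only), which cut the word
   into increasing segments, and by forced repeats at the positions t + c - 1,
   t in T; changing c only moves the repeats inside their segments.  Reading the
   word segment by segment, from the right, one sees by induction that the number
   of such words with set of letters V depends only on #|V| and on the number of
   forced repeats in each segment. *)

Set Implicit Arguments.
Unset Strict Implicit.
Unset Printing Implicit Defensive.

(** * Order isomorphism with an increasing block followed by a repeated letter *)

Lemma standardize_rcons_nth (r : seq nat) (c : nat) :
  sorted ltn r -> c < size r ->
  standardize (rcons r (nth 0 r c)) = rcons (iota 1 (size r)) c.+1.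
Proof.
move=> r_sorted c_lt.
have r_uniq : uniq r by move: r_sorted; rewrite ltn_sorted_uniq_leq => /andP[].
(* The appended letter already occurs in [r], so it adds no distinct letter. *)
have sortE : sort leq (undup (rcons r (nth 0 r c))) = r.
  apply: (irr_sorted_eq ltn_trans ltnn) => //.
    by rewrite ltn_sorted_uniq_leq sort_uniq undup_uniq sort_sorted //; exact: leq_total.
  move=> x; rewrite mem_sort mem_undup mem_rcons inE.
  by case: eqP => // ->; rewrite mem_nth.
rewrite /standardize sortE map_rcons index_uniq //; congr rcons.
apply: (@eq_from_nth _ 0); rewrite size_map ?size_iota // => j j_lt.
by rewrite (nth_map 0) // nth_iota // index_uniq.
Qed.

(** As c is at most i, the last letter of the pattern repeats a block letter, so [x] brings no new
    value to be compared with the block. *)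
Lemma order_isomorphic_increasing (i c : nat) (r : seq nat) (x : nat) :
  0 < c <= i -> size r = i ->
  order_isomorphic (rcons r x) (rcons (iota 1 i) c)
  = sorted ltn r && (x == nth 0 r c.-1).
Proof.
case: c => // c c_lt size_r; rewrite /order_isomorphic /=.
have -> : standardize (rcons (iota 1 i) c.+1) = rcons (iota 1 i) c.+1.
  have := @standardize_rcons_nth (iota 1 i) c (iota_ltn_sorted _ _).
  by rewrite size_iota nth_iota // add1n; apply.
apply/eqP/andP=> [|[r_sorted /eqP ->]]; last first.
  by rewrite standardize_rcons_nth ?size_r.
set s := rcons r x; rewrite /standardize; set t := sort leq (undup s) => st.
have t_sorted : sorted ltn t.
  by rewrite ltn_sorted_uniq_leq sort_uniq undup_uniq sort_sorted //; exact: leq_total.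
have mem_t y : (y \in t) = (y \in s) by rewrite mem_sort mem_undup.
have size_s : size s = i.+1 by rewrite size_rcons size_r.
have nth_s j : j < i -> nth 0 s j = nth 0 r j.
  by move=> j_lt; rewrite nth_rcons size_r j_lt.
(* The entries of [st] before position i give the j-th letter of [r] rank j in [t]; its entry at
   position i will give [x] the rank of the letter it must equal. *)
have index_t j : j < i -> index (nth 0 r j) t = j.
  move=> j_lt; have := congr1 (fun u => nth 0 u j) st.
  rewrite (nth_map 0) ?size_s ?ltnS 1?ltnW // nth_s // nth_rcons size_iota j_lt.
  by rewrite nth_iota // => -[].
have mem_r j : j < i -> nth 0 r j \in t.
  by move=> j_lt; rewrite mem_t mem_rcons inE mem_nth ?size_r ?orbT.
split.
  apply/(sortedP 0) => j; rewrite size_r => j_lt.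
  by apply: (sorted_ltn_index ltn_trans t_sorted);
     rewrite ?mem_r ?index_t // ltnW.
have := congr1 (fun u => nth 0 u i) st.
rewrite (nth_map 0) ?size_s // /s !nth_rcons size_iota size_r ltnn eqxx => -[index_x].
have x_t : x \in t by rewrite mem_t mem_rcons inE eqxx.
by rewrite -(nth_index 0 x_t) index_x -{1}(index_t c) // nth_index ?mem_r.
Qed.

(** * Inversion over subsets, and sums over intervals of sets *)

(* Moebius inversion over the subset lattice, without signs: descend from the
   full set. *)
Lemma card_fiber_set (W I : finType) (B B' : W -> {set I}) :
  (forall T : {set I}, #|[set w | T \subset B w]| = #|[set w | T \subset B' w]|) ->
  forall T : {set I}, #|[set w | B w == T]| = #|[set w | B' w == T]|.
Proof.
(* The induction is on the complement of [T], which shrinks for proper supersets. *)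
move=> cardB T; have [m] := ubnP #|~: T|.
elim: m T => // m IHm T cardT.
have split_up (C : W -> {set I}) : #|[set w | T \subset C w]| =
    #|[set w | C w == T]| + \sum_(S : {set I} | T \proper S) #|[set w | C w == S]|.
  rewrite -sum1dep_card (partition_big C (fun S => T \subset S)) //=.
  rewrite (bigD1 T) //=; congr (_ + _).
    rewrite sum1dep_card; apply: eq_card => w; rewrite !inE.
    by case: eqP => [->|]; rewrite ?subxx ?andbF.
  apply: eq_big => [S|S /andP[TS _]]; first by rewrite properEneq eq_sym andbC.
  rewrite sum1dep_card; apply: eq_card => w; rewrite !inE.
  by case: eqP => [->|]; rewrite ?TS ?andbF.
apply/eqP; rewrite -(eqn_add2r (\sum_(S : {set I} | T \proper S) #|[set w | B w == S]|)).
rewrite -split_up cardB split_up eqn_add2l; apply/eqP/eq_bigr => S TS.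
rewrite IHm //; move: cardT; rewrite ltnS; apply: leq_trans.
by rewrite proper_card // properC.
Qed.

(** The sets between [B] and [V] are the disjoint unions of [B] with a subset of [V :\: B]. Hence
    the sum depends on the sizes of [B] and [V] only. *)
Lemma sum_between (I : finType) (B V : {set I}) (g : nat -> nat) :
  B \subset V ->
  \sum_(U : {set I} | (B \subset U) && (U \subset V)) g #|U| =
  \sum_(j < (#|V| - #|B|).+1) 'C(#|V| - #|B|, j) * g (#|B| + j).
Proof.
move=> BV.
rewrite (reindex_onto (fun X => X :|: B) (fun U => U :\: B)) /=; last first.
  move=> U /andP[BU _]; apply/setP => x; rewrite !inE.
  by case: (boolP (x \in B)) => [/(subsetP BU) ->|]; rewrite ?orbF.
have predE X : (B \subset X :|: B) && (X :|: B \subset V) && ((X :|: B) :\: B == X)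
    = (X \subset V :\: B).
  rewrite subsetUr subUset BV andbT /= setDUl setDv setU0 subsetD.
  by congr (_ && _); apply/eqP/setDidPl.
rewrite (eq_bigl _ _ predE).
have cardVB : #|V :\: B| = #|V| - #|B| by rewrite cardsD (setIidPr BV).
rewrite (partition_big (fun X : {set I} => inord #|X| : 'I_(#|V| - #|B|).+1) xpredT) //=.
apply: eq_bigr => j _; rewrite -[X in 'C(X, _)]cardVB -cards_draws -sum1dep_card big_distrl /=.
apply: eq_big => [X|X /andP[XVB /eqP <-]].
  case: (boolP (X \subset _)) => //= XVB; rewrite -val_eqE /= inordK //.
  by rewrite ltnS -cardVB subset_leq_card.
rewrite mul1n inordK; last by rewrite ltnS -cardVB subset_leq_card.
have /disjoint_setI0 XB : [disjoint X & B] by move: XVB; rewrite subsetD => /andP[].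
by rewrite cardsU XB cards0 subn0 addnC.
Qed.

(** * Constrained words and their first segment *)

(* [D] prescribes ascents, [A] prescribes letters that reappear later on.  An
   ascent prescribed at the last position makes the predicate false. *)
Definition constrained (D A : pred nat) (s : seq nat) : bool :=
  all (fun p => (D p ==> (p.+1 < size s) && (nth 0 s p < nth 0 s p.+1)) &&
                (A p ==> (nth 0 s p \in drop p.+1 s)))
      (iota 0 (size s)).

(** The hypotheses on [D] make [r] the first segment. Its letters are then distinct, so a letter of
    [r] can reappear only in [s]. *)
Lemma constrained_cat (D A : pred nat) (r s : seq nat) :
  0 < size r -> (forall p, p < (size r).-1 -> D p) -> ~~ D (size r).-1 ->
  constrained D A (r ++ s) =
  [&& sorted ltn r, all (fun q => A q ==> (nth 0 r q \in s)) (iota 0 (size r))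
    & constrained (fun p => D (size r + p)) (fun p => A (size r + p)) s].
Proof.
move=> r_gt0 Dr DrN; rewrite /constrained size_cat iotaD all_cat andbA.
congr (_ && _); last first.
  rewrite add0n -[X in iota X _]addn0 iotaDl all_map; apply: eq_all => p /=.
  have nthD q : nth 0 (r ++ s) (size r + q) = nth 0 s q.
    by rewrite nth_cat ltnNge leq_addr addKn.
  have dropD q : drop (size r + q) (r ++ s) = drop q s.
    by rewrite drop_cat ltnNge leq_addr addKn.
  by rewrite -addnS !nthD dropD ltn_add2l.
have reappears q : sorted ltn r -> q < size r ->
    (nth 0 (r ++ s) q \in drop q.+1 (r ++ s)) = (nth 0 r q \in s).
  move=> r_sorted q_lt; rewrite nth_cat q_lt.
  have -> : drop q.+1 (r ++ s) = drop q.+1 r ++ s.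
    rewrite drop_cat; case: ltnP => // q_ge.
    by rewrite [drop _ r]drop_oversize // (_ : _ - _ = 0) ?drop0 //; lia.
  rewrite mem_cat; case: (boolP (_ \in drop _ _)) => //= q_in.
  have : uniq (drop q r).
    by apply: drop_uniq; apply: (sorted_uniq ltn_trans ltnn).
  by rewrite (drop_nth 0) //= q_in.
apply/allP/andP => [cr|[r_sorted /allP cr] q].
  have r_sorted : sorted ltn r.
    apply/(sortedP 0) => p p_lt.
    have := cr p; rewrite mem_iota /= add0n (ltnW p_lt) => /(_ isT).
    by rewrite Dr ?nth_cat ?(ltnW p_lt) ?p_lt; [case/andP=> /andP[] | lia].
  split=> //; apply/allP => q q_in; have /andP[_] := cr q q_in.
  by rewrite reappears //; move: q_in; rewrite mem_iota.
move=> q_in; have q_lt : q < size r by move: q_in; rewrite mem_iota.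
rewrite reappears // cr // andbT; apply/implyP => Dq.
(* No ascent is prescribed at the last position of [r], so none straddles the cut. *)
have q1_lt : q.+1 < size r.
  case: (ltngtP q.+1 (size r)) => //; first by lia.
  by move=> q1; rewrite -q1 /= Dq in DrN.
rewrite !nth_cat q_lt q1_lt (leq_trans q1_lt) ?leq_addr //=.
exact: (sortedP 0 r_sorted).
Qed.

(** * Tuples as words, and increasing tuples *)

Lemma mem_letters (n k : nat) (w : n.-tuple 'I_k) (x : 'I_k) :
  (x.+1 \in letters w) = (x \in w).
Proof. by rewrite (mem_map (f := fun y : 'I_k => y.+1)) // => y z [/val_inj]. Qed.

Lemma nth_letters (n k : nat) (w : n.-tuple 'I_k) (q : 'I_n) :
  nth 0 (letters w) q = (tnth w q).+1.
Proof.
by rewrite (tnth_nth (tnth w q)) (nth_map (tnth w q)) // size_tuple.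
Qed.

Lemma sorted_letters_uniq (n k : nat) (w : n.-tuple 'I_k) :
  sorted ltn (letters w) -> uniq w.
Proof. by move=> /(sorted_uniq ltn_trans ltnn) /map_uniq. Qed.

(** An increasing word is determined by its set of letters, and [enum] lists any set of letters in
    increasing order. *)
Lemma card_sorted_tuples_in (k l : nat) (V : {set 'I_k}) :
  #|[set r : l.-tuple 'I_k | sorted ltn (letters r) && ([set x in r] \subset V)]|
  = 'C(#|V|, l).
Proof.
rewrite -cards_draws -(card_in_imset (f := fun r : l.-tuple 'I_k => [set x in r])).
  apply: eq_card => R; apply/imsetP/idP => [[r]|].
    rewrite !inE => /andP[r_sorted rV] ->; rewrite rV cardsE /=.
    by rewrite (card_uniqP _) ?size_tuple // sorted_letters_uniq.
  rewrite inE => /andP[RV /eqP cardR].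
  have size_R : size (enum R) == l by rewrite -cardE cardR.
  exists (Tuple size_R); last by apply/setP => x; rewrite inE mem_enum.
  rewrite inE; apply/andP; split; last first.
    by apply/subsetP => x; rewrite inE mem_enum => /(subsetP RV).
  rewrite /letters /= sorted_map /enum_mem sorted_filter //.
    by move=> x y z; apply: ltn_trans.
  rewrite (_ : sorted _ _ = sorted ltn [seq val x | x <- enum 'I_k]).
    by rewrite val_enum_ord iota_ltn_sorted.
  by rewrite sorted_map enumT.
move=> r r'; rewrite !inE /letters !sorted_map => /andP[r_sorted _] /andP[r'_sorted _] rr'.
apply/val_inj/(irr_sorted_eq (leT := relpre (fun x : 'I_k => x.+1) ltn)) => //.
- by move=> x y z; apply: ltn_trans.
- by move=> x /=; rewrite ltnn.
- by move=> x; move/setP/(_ x): rr'; rewrite !inE.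
Qed.

Lemma sum_cat_tuple (T : finType) (l m : nat) (F : (l + m).-tuple T -> nat) :
  \sum_w F w = \sum_(r : l.-tuple T) \sum_(s : m.-tuple T) F (cat_tuple r s).
Proof.
rewrite pair_bigA (reindex (fun p : l.-tuple T * m.-tuple T => cat_tuple p.1 p.2)) //.
apply/onW_bij/inj_card_bij; last by rewrite card_prod !card_tuple expnD.
move=> [r s] [r' s'] /(congr1 val) /= /eqP.
by rewrite eqseq_cat ?size_tuple // => /andP[/eqP/val_inj -> /eqP/val_inj ->].
Qed.

Lemma count_iota_card (A : pred nat) (l : nat) :
  count A (iota 0 l) = #|[set q : 'I_l | A q]|.
Proof. by rewrite -sum1_count -{1}(subn0 l) big_mkord sum1dep_card. Qed.

(** * Counting constrained words segment by segment *)

(** The exact set of letters is recorded because a segment interacts with the rest of the word only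
    through the set of letters of that rest. *)
Definition num_constrained (n k : nat) (D A : pred nat) (V : {set 'I_k}) : nat :=
  #|[set w : n.-tuple 'I_k | constrained D A (letters w) && ([set x in w] == V)]|.

(* The block is chosen first: given a sorted block with set of letters [R], the
   set of letters of the rest of the word ranges over the sets between
   [(V :\: R) :|: M] and [V], where [M] are the letters of the block that must
   reappear; of [A] only the size of [M] matters. *)
Lemma num_constrained_block (k l m : nat) (D A : pred nat) (g : nat -> nat)
    (V : {set 'I_k}) :
  0 < l -> (forall p, p < l.-1 -> D p) -> ~~ D l.-1 ->
  (forall U : {set 'I_k},
     num_constrained m (fun p => D (l + p)) (fun p => A (l + p)) U = g #|U|) ->
  let b := #|V| - l + count A (iota 0 l) in
  num_constrained (l + m) D A V =
  'C(#|V|, l) * \sum_(j < (#|V| - b).+1) 'C(#|V| - b, j) * g (b + j).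
Proof.
move=> l_gt0 Dl DlN Ng b.
rewrite /num_constrained -sum1dep_card big_mkcond sum_cat_tuple /=.
(* The binomial becomes a sum over increasing blocks [r] with letters in [V], and the two sides are
   compared for each [r]. Such a block forces l to be at most [#|V|], so the subtraction in [b] is
   not truncated. *)
rewrite -card_sorted_tuples_in -sum1dep_card big_distrl /= [RHS]big_mkcond /=.
apply: eq_bigr => r _.
have size_r : size (letters r) = l by rewrite size_map size_tuple.
have condE (s : m.-tuple 'I_k) :
    constrained D A (letters (cat_tuple r s)) =
    [&& sorted ltn (letters r),
      all (fun q => A q ==> (nth 0 (letters r) q \in letters s)) (iota 0 l)
    & constrained (fun p => D (l + p)) (fun p => A (l + p)) (letters s)].
  by rewrite {1}/letters /= map_cat constrained_cat size_r.
rewrite -big_mkcond /=.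
case: (boolP (sorted ltn (letters r))) => [r_sorted|/negbTE r_sortedN] /=; last first.
  by apply: big_pred0 => s; rewrite condE r_sortedN.
case: (boolP ([set x in r] \subset V)) => [rV|rVN]; last first.
  apply: big_pred0 => s; apply/negbTE; apply: contra rVN => /andP[_ /eqP <-].
  by apply/subsetP => x; rewrite !inE mem_cat => ->.
have r_uniq := sorted_letters_uniq r_sorted.
pose M := [set tnth r q | q in [set q : 'I_l | A q]].
pose B := (V :\: [set x in r]) :|: M.
have MR : M \subset [set x in r].
  by apply/subsetP => x /imsetP[q _ ->]; rewrite inE mem_tnth.
have BV : B \subset V by rewrite subUset subsetDl (subset_trans MR).
have cardR : #|[set x in r]| = l by rewrite cardsE (card_uniqP r_uniq) size_tuple.
have cardB : #|B| = b.
  rewrite cardsU (disjoint_setI0 _).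
    rewrite cards0 subn0 cardsD (setIidPr rV) cardR card_imset; last by apply/tuple_uniqP.
    by rewrite /b count_iota_card.
  by apply: disjointWr MR _; rewrite -setI_eq0 setIDAC setDIl setDv setI0.
have allM (s : m.-tuple 'I_k) :
    all (fun q => A q ==> (nth 0 (letters r) q \in letters s)) (iota 0 l)
    = (M \subset [set x in s]).
  apply/allP/subsetP => [rs x /imsetP[q] | Ms q].
    rewrite inE => Aq ->; have := rs q; rewrite mem_iota ltn_ord => /(_ isT).
    by rewrite Aq nth_letters mem_letters inE.
  rewrite mem_iota /= add0n => q_lt; apply/implyP => Aq.
  rewrite (nth_letters r (Ordinal q_lt)) mem_letters.
  by have := Ms (tnth r (Ordinal q_lt)); rewrite inE; apply; rewrite imset_f ?inE.
have BE (U : {set 'I_k}) : (M \subset U) && ([set x in r] :|: U == V)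
    = (B \subset U) && (U \subset V).
  apply/andP/andP => [[MU /eqP VE]|].
    by rewrite subUset MU -VE subsetUr setDUl setDv set0U subsetDl.
  rewrite subUset => -[/andP[VU ->] UV]; split=> //.
  by rewrite eqEsubset subUset rV UV -subDset VU.
rewrite mul1n -cardB -sum_between //.
transitivity (\sum_(s : m.-tuple 'I_k |
    constrained (fun p => D (l + p)) (fun p => A (l + p)) (letters s) &&
    ((B \subset [set x in s]) && ([set x in s] \subset V))) 1).
  apply: eq_bigl => s; rewrite condE r_sorted allM -BE /= [in RHS]andbCA andbA.
  by congr (_ && (_ == V)); apply/setP => x; rewrite !inE mem_cat.
rewrite (partition_big (fun s : m.-tuple 'I_k => [set x in s])
           (fun U => (B \subset U) && (U \subset V))) => [|s /andP[]] //=.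
apply: eq_bigr => U BUV; rewrite -Ng sum1dep_card.
apply: eq_card => s; rewrite !inE.
by case: eqP => [->|]; rewrite ?BUV ?andbF ?andbT.
Qed.

Lemma count_iotaD (A : pred nat) (l p : nat) :
  count A (iota 0 (l + p)) =
  count A (iota 0 l) + count (fun q => A (l + q)) (iota 0 p).
Proof. by rewrite iotaD count_cat add0n -[X in iota X p]addn0 iotaDl count_map. Qed.

(** Positions without a prescribed ascent are the segment ends. Equal counts up to every segment end
    mean equally many forced repeats in each segment. *)
Lemma num_constrained_eq (n k : nat) (D A A' : pred nat) (V V' : {set 'I_k}) :
  (forall p, p < n -> ~~ D p -> count A (iota 0 p.+1) = count A' (iota 0 p.+1)) ->
  #|V| = #|V'| ->
  num_constrained n D A V = num_constrained n D A' V'.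
Proof.
have [N] := ubnP n.
elim: N n D A A' V V' => // N IHN n D A A' V V' n_lt AA' VV'.
(* If every position prescribes an ascent, so does the last one, and only the empty word can
   qualify. *)
case: (boolP [exists p : 'I_n, ~~ D p]) => [DN|/existsPn Dall]; last first.
  case: n n_lt AA' Dall => [|n] n_lt AA' Dall.
    have num0 (B : pred nat) (U : {set 'I_k}) : num_constrained 0 D B U = (#|U| == 0).
      rewrite cards_eq0 /num_constrained -sum1dep_card big_mkcond /=.
      rewrite (big_pred1 [tuple]) => [|w]; last by rewrite [w]tuple0; apply/esym/eqP.
      rewrite (_ : [set x in [tuple]] = set0); last by apply/setP.
      by rewrite /= [set0 == U]eq_sym; case: (U == set0).
    by rewrite !num0 VV'.
  have num0 (B : pred nat) (U : {set 'I_k}) : num_constrained n.+1 D B U = 0.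
    apply: eq_card0 => w; rewrite inE; apply/negbTE/andP => -[/allP cw _].
    have /cw : n \in iota 0 (size (letters w)).
      by rewrite size_map size_tuple mem_iota /=.
    have := Dall ord_max; rewrite negbK => -> /=.
    by rewrite size_map size_tuple ltnn.
  by rewrite !num0.
have exD : exists p, (p < n) && ~~ D p.
  by have [p Dp] := existsP DN; exists p; rewrite ltn_ord.
(* The least position without a prescribed ascent ends the first segment. *)
case: (ex_minnP exD) => p /andP[p_lt Dp] p_min {DN exD}.
have Dl q : q < p -> D q.
  move=> q_lt; apply: contraLR (q_lt) => DqN; rewrite -leqNgt p_min // DqN.
  by rewrite (ltn_trans q_lt).
have [m nE] : exists m, n = p.+1 + m by exists (n - p.+1); rewrite subnKC.
subst n.
pose D1 q := D (p.+1 + q); pose A1 q := A (p.+1 + q); pose A1' q := A' (p.+1 + q).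
have AA1 q : q < m -> ~~ D1 q -> count A1 (iota 0 q.+1) = count A1' (iota 0 q.+1).
  move=> q_lt D1q; have := AA' (p.+1 + q); rewrite ltn_add2l => /(_ q_lt D1q).
  by rewrite -addnS !count_iotaD (AA' p) // => /addnI.
have m_lt : m < N by lia.
(* By induction the count for the rest depends on [#|U|] only, so any set of size [u] may represent
   it; the default covers sizes above k. *)
pose g u := if [pick U : {set 'I_k} | #|U| == u] is Some U
            then num_constrained m D1 A1 U else 0.
have Ng (U : {set 'I_k}) : num_constrained m D1 A1 U = g #|U|.
  rewrite /g; case: pickP => [U' /eqP UU'|/(_ U)]; last by rewrite eqxx.
  exact: IHN.
have Ng' (U : {set 'I_k}) : num_constrained m D1 A1' U = g #|U| by rewrite -Ng; apply/esym/IHN.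
rewrite (num_constrained_block V _ _ _ Ng) // (num_constrained_block V' _ _ _ Ng') //.
by rewrite VV' AA'.
Qed.

(** * Occurrences as forced ascents and forced repeats *)

Lemma increasing_occursP (i c p : nat) (s : seq nat) : 1 < i -> 0 < c <= i ->
  (exists2 q, q < size s & occurs_at (increasing_pattern i c) s p q) <->
  (forall j, p <= j < p + i.-1 -> (j.+1 < size s) && (nth 0 s j < nth 0 s j.+1)) /\
  nth 0 s (p + c.-1) \in drop (p + c.-1).+1 s.
Proof.
move=> i_gt1 c_i; have c_lt : c.-1 < i by lia.
have blockP : p + i <= size s ->
    [/\ size (take i (drop p s)) = i &
        forall j, j < i -> nth 0 (take i (drop p s)) j = nth 0 s (p + j)].
  move=> pi; split=> [|j j_lt]; last by rewrite nth_take // nth_drop.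
  by rewrite size_takel // size_drop; lia.
split=> [[q q_lt]|[asc]].
  rewrite /occurs_at /= size_iota /underlying /= => /andP[pq].
  have [size_b nth_b] := blockP (leq_trans pq (ltnW q_lt)).
  rewrite order_isomorphic_increasing // => /andP[/(sortedP 0) b_sorted /eqP qE].
  split=> [j /andP[pj ji]|].
    have := b_sorted (j - p); rewrite size_b !nth_b; try lia.
    by rewrite addnS subnKC // => asc_j; apply/andP; split; [lia | apply: asc_j; lia].
  have cq : (p + c.-1).+1 <= q by lia.
  rewrite -nth_b // -qE -{1}(subnKC cq) -nth_drop mem_nth // size_drop.
  exact: ltn_sub2r (leq_ltn_trans cq q_lt) q_lt.
move=> /(nthP 0)[q0]; rewrite size_drop nth_drop ltn_subRL.
have [q qD] : exists q, q = (p + c.-1).+1 + q0.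
  by exists ((p + c.-1).+1 + q0).
rewrite -qD => q_lt qE.
(* As i is at least 2, the block has a last ascent, at [p + i.-2], whose bound makes the block fit
   in [s]. *)
have pi : p + i <= size s by have := asc (p + i.-2); lia.
have [size_b nth_b] := blockP pi.
have b_sorted : sorted ltn (take i (drop p s)).
  apply/(sortedP 0) => j; rewrite size_b => j_lt; rewrite !nth_b ?(ltnW j_lt) //.
  by have := asc (p + j); rewrite addnS => /(_ _)/andP[] //; lia.
exists q => //; rewrite /occurs_at /= size_iota order_isomorphic_increasing //.
(* A repeat inside the block would contradict its strict increase, so [q] lies beyond the block. *)
rewrite b_sorted nth_b // qE eqxx !andbT leqNgt; apply/negP => q_lt'.
have := sorted_ltn_nth ltn_trans 0 b_sorted c.-1 (q - p).
rewrite !inE size_b !nth_b; try lia.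
rewrite (_ : p + (q - p) = q); last by lia.
by rewrite qE ltnn; lia.
Qed.

Definition block_starts (n k i c : nat) (w : n.-tuple 'I_k) : {set 'I_n} :=
  [set p : 'I_n | [exists q : 'I_n, occurs_at (increasing_pattern i c) (letters w) p q]].

Definition forced_ascents (n i : nat) (T : {set 'I_n}) : pred nat :=
  fun p => [exists t in T, t <= p < t + i.-1].

Definition forced_repeats (n c : nat) (T : {set 'I_n}) : pred nat :=
  fun p => [exists t in T, t + c.-1 == p].

Lemma avoids_block_starts (n k i c : nat) (w : n.-tuple 'I_k) :
  avoids (increasing_pattern i c) (letters w) = (block_starts i c w == set0).
Proof.
have size_w : size (letters w) = n by rewrite size_map size_tuple.
rewrite /avoids -[RHS]negbK; congr (~~ _).
apply/existsP/set0Pn => [[p /existsP[q pq]]|[p]].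
  exists (cast_ord size_w p); rewrite inE; apply/existsP.
  by exists (cast_ord size_w q).
rewrite inE => /existsP[q pq]; exists (cast_ord (esym size_w) p).
by apply/existsP; exists (cast_ord (esym size_w) q).
Qed.

Lemma sub_block_starts (n k i c : nat) (T : {set 'I_n}) (w : n.-tuple 'I_k) :
  1 < i -> 0 < c <= i ->
  (T \subset block_starts i c w) =
  constrained (forced_ascents i T) (forced_repeats c T) (letters w).
Proof.
move=> i_gt1 c_i; have size_w : size (letters w) = n by rewrite size_map size_tuple.
have startsP (p : 'I_n) : reflect
    (exists2 q, q < size (letters w) &
      occurs_at (increasing_pattern i c) (letters w) p q)
    (p \in block_starts i c w).
  rewrite inE size_w; apply: (iffP existsP) => [[q]|[q q_lt]]; first by exists q.
  by exists (Ordinal q_lt).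
apply/subsetP/allP => [Tw p _ | cw t tT].
  apply/andP; split; apply/implyP => /existsP[t /andP[tT]].
    move=> tp; have /startsP/increasing_occursP[] // := Tw t tT.
    by move=> asc _; apply: asc.
  by move=> /eqP <-; have /startsP/increasing_occursP[] := Tw t tT.
have asc j : t <= j < t + i.-1 ->
    (j.+1 < size (letters w)) && (nth 0 (letters w) j < nth 0 (letters w) j.+1).
  have asc_lt j' : j' < n -> t <= j' < t + i.-1 ->
      (j'.+1 < size (letters w)) && (nth 0 (letters w) j' < nth 0 (letters w) j'.+1).
    move=> j'_lt tj'; have := cw j'; rewrite mem_iota size_w => /(_ j'_lt)/andP[+ _].
    by move/implyP; apply; apply/existsP; exists t; rewrite tT.
  move=> tj; have t_lt := ltn_ord t.
  (* [constrained] tests only positions below n, but a block running past the end would prescribe an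
     ascent at the last position, which is impossible. *)
  case: (ltnP j n) => [/asc_lt|n_le]; first exact.
  have := asc_lt n.-1; rewrite size_w prednK ?ltnn; lia.
apply/startsP/increasing_occursP => //; split=> //.
have tc_lt : t + c.-1 < n.
  (* For c > 1 the position is the upper end of the ascent at [t + c.-2]; for c = 1 it is [t]
     itself. *)
  case: (ltnP 1 c) => [c_gt1|c_le]; last by have := ltn_ord t; lia.
  by have := asc (t + c.-2); rewrite size_w; lia.
have := cw (t + c.-1); rewrite mem_iota size_w => /(_ tc_lt)/andP[_].
by move/implyP; apply; apply/existsP; exists t; rewrite tT /=.
Qed.

(** A block starting at or before a segment end [p] has ended by [p], and its forced repeat with it.
    So each such [t] contributes one repeat, whatever c is. *)
Lemma count_forced_repeats (n i c : nat) (T : {set 'I_n}) (p : nat) :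
  0 < c <= i -> ~~ forced_ascents i T p ->
  count (forced_repeats c T) (iota 0 p.+1) = #|[set t in T | t <= p]|.
Proof.
move=> c_i /existsPn Tp.
have tc_le t : t \in [set t in T | t <= p] -> t + c.-1 < p.+1.
  by rewrite inE => /andP[tT tp]; have := Tp t; rewrite tT tp /=; lia.
rewrite count_iota_card.
rewrite -(card_in_imset (f := fun t : 'I_n => inord (t + c.-1) : 'I_p.+1)).
  apply: eq_card => q; rewrite inE; apply/existsP/imsetP => [[t /andP[tT /eqP tq]]|].
    exists t; first by rewrite inE tT; have := ltn_ord q; lia.
    by apply: val_inj; rewrite /= inordK tq.
  move=> [t tT ->]; exists t; rewrite inordK ?tc_le // eqxx andbT.
  by move: tT; rewrite inE => /andP[].
move=> t t' tT t'T /(congr1 val); rewrite /= !inordK ?tc_le // => /addIn.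
exact: val_inj.
Qed.

Theorem theorem2p3 (i c d : nat) (hi : 2 <= i)
    (hc : 1 <= c <= i) (hd : 1 <= d <= i) :
  wilf_equivalent (increasing_pattern i c) (increasing_pattern i d).
Proof.
move=> n k _; rewrite /num_avoiders.
have avoidE e : [set w : n.-tuple 'I_k | avoids (increasing_pattern i e) (letters w)]
    = [set w | block_starts i e w == set0].
  by apply/setP => w; rewrite !inE avoids_block_starts.
(* Avoidance is the fiber over the empty set, so it suffices to count the words whose starts include
   a given [T]. *)
rewrite !avoidE; apply: card_fiber_set => T.
have numE e : 1 <= e <= i -> #|[set w : n.-tuple 'I_k | T \subset block_starts i e w]| =
    \sum_(V : {set 'I_k}) num_constrained n (forced_ascents i T) (forced_repeats e T) V.
  move=> he; rewrite -sum1dep_card.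
  rewrite (partition_big (fun w : n.-tuple 'I_k => [set x in w]) xpredT) //=.
  apply: eq_bigr => V _; rewrite sum1dep_card; apply: eq_card => w.
  by rewrite !inE sub_block_starts.
rewrite !numE //; apply: eq_bigr => V _; apply: num_constrained_eq => // p _ Tp.
by rewrite (count_forced_repeats hc) ?(count_forced_repeats hd).
Qed.
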